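(* Let $d$ be odd and let $\sigma_\diamond$ be a sign pattern of length $d+1$ with which the pair $(3,0)$ is compatible. If $\sigma_\diamond$ is not of the form $D(a,b,c)$ for any integers $a,b,c\geq1$ with $2a+2b+2c=d+1$, then the couple $(\sigma_\diamond,(3,0))$ is realizable, i.e. there is a monic degree-$d$ real polynomial with all coefficients non-zero, defining $\sigma_\diamond$, with exactly three real roots, all positive and simple.
   Context: A sign pattern of length $d+1$ is a sequence of $d+1$ symbols $+$/$-$ beginning with $+$; a monic polynomial $x^d+\sum_{j<d}a_jx^j$ with all $a_j\neq0$ defines the sign pattern $(+,\operatorname{sign}(a_{d-1}),\ldots,\operatorname{sign}(a_0))$. For a sign pattern with $c$ sign changes and $p$ sign preservations ($c+p=d$), a pair $(pos,neg)$ is compatible with it if $pos\le c$, $c-pos$ even, $neg\le p$, $p-neg$ even. A monic polynomial realizes $(\sigma,(pos,neg))$ if it has all coefficients non-zero, defines $\sigma$, has exactly $pos$ positive and $neg$ negative real roots, all simple, and no other real roots. For $d$ odd and integers $a,b,c\geq1$ with $2a+2b+2c=d+1$, $D(a,b,c)$ denotes the sign pattern (listed from the coefficient of $x^d$ down to the constant term) consisting of $2a$ pluses, followed by $b$ pairs ''$-,+$'', followed by $2c$ minuses. *)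

(* Defs.v *)
From HB Require Import structures.
From mathcomp Require Import all_boot all_order all_algebra.
From mathcomp Require Import Rstruct.
Set Implicit Arguments. Unset Strict Implicit. Unset Printing Implicit Defensive.
Import Order.TTheory GRing.Theory Num.Theory.
Local Open Scope ring_scope.

(* A sign pattern is a seq bool: true = '+', false = '-',
   listed from the coefficient of x^d down to the constant term. *)
Definition sign_pattern (d : nat) (s : seq bool) : Prop :=
  size s = d.+1 /\ head false s = true.

Definition sign_changes (s : seq bool) : nat :=
  count (fun i => nth false s i != nth false s i.+1) (iota 0 (size s).-1).

Definition sign_preservations (s : seq bool) : nat :=
  count (fun i => nth false s i == nth false s i.+1) (iota 0 (size s).-1).

Definition compatible (s : seq bool) (pos neg : nat) : Prop :=
  (pos <= sign_changes s)%N /\ ~~ odd (sign_changes s - pos)%N /\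
  (neg <= sign_preservations s)%N /\ ~~ odd (sign_preservations s - neg)%N.

Definition Dpat (a b c : nat) : seq bool :=
  nseq (2 * a) true ++ flatten (nseq b [:: false; true]) ++ nseq (2 * c) false.

Definition defines (p : {poly Rdefinitions.R}) (s : seq bool) : Prop :=
  let d := (size s).-1 in
  size p = d.+1 /\ p \is monic /\
  (forall i : nat, (i <= d)%N -> p`_i != 0) /\
  (forall i : nat, (i <= d)%N -> (0 < p`_(d - i)) = nth false s i).

Definition realizes (p : {poly Rdefinitions.R}) (s : seq bool) (pos neg : nat) : Prop :=
  defines p s /\
  exists (rp rn : seq Rdefinitions.R),
    [/\ uniq rp, uniq rn, size rp = pos & size rn = neg] /\
    all (fun x => 0 < x) rp /\ all (fun x => x < 0) rn /\
    (forall x : Rdefinitions.R, root p x <-> x \in rp ++ rn) /\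
    (forall x : Rdefinitions.R, x \in rp ++ rn -> ~~ root p^`() x).

(* Main.v *)
Require Import Defs.
From HB Require Import structures.
From mathcomp Require Import all_boot all_order all_algebra all_field.
From mathcomp Require Import Rstruct zify ring lra polyrcf.
From Stdlib Require Ranalysis1 Rtopology.
Import Order.TTheory GRing.Theory Num.Theory.
Local Open Scope ring_scope.

(* Index signs by degrees. If the pattern is not some [Dpat a b c], there are
   degrees d > i > j > 0 carrying the signs - and +, with i even or j odd. For
   these parities some four-term polynomial e x^d - a x^i + b x^j - c with
   e, a, b, c > 0 has three positive roots and no root on the closed negative
   half-line: combine a weighted AM-GM gap, which has a double zero at 1, with a
   small monomial. By Rolle's theorem it factors as Q (x - x1)(x - x2)(x - x3)
   with Q free of real roots. The missing monomials are added with small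
   coefficients of the prescribed signs, correcting the coefficients of x^i, x^j
   and 1 by interpolation so that x1, x2, x3 remain roots: the cofactor is
   then a small perturbation of Q, hence still has no real root. *)

(** * Combinatorics of sign patterns *)

Lemma sign_changes_cons2 (x y : bool) (s : seq bool) :
  sign_changes [:: x, y & s] = ((x != y) + sign_changes (y :: s))%N.
Proof.
rewrite /sign_changes /= -[1%N]/(1 + 0)%N iotaDl count_map.
by congr (_ + _)%N; apply: eq_count.
Qed.

Lemma odd_sign_changes (x : bool) (s : seq bool) :
  odd (sign_changes (x :: s)) = (x != last x s).
Proof.
elim: s x => [|y s IHs] x; first by rewrite eqxx.
by rewrite sign_changes_cons2 oddD IHs /=; case: x y (last y s) => [] [] [].
Qed.

(** With no minus before a plus, the pattern is a block of pluses followed by a block of minuses.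
    Bounding by the head, read as 0 or 1, makes the induction close. *)
Lemma sign_changes_no_ascent (s : seq bool) :
  (forall p q, (p < q < size s)%N -> nth false s p || ~~ nth false s q) ->
  (sign_changes s <= head false s)%N.
Proof.
elim: s => [|x [|y s] IHs] // noasc; rewrite sign_changes_cons2.
have /IHs {}IHs : forall p q, (p < q < size (y :: s))%N ->
    nth false (y :: s) p || ~~ nth false (y :: s) q.
  by move=> p q pq; apply: (noasc p.+1 q.+1).
have /= := noasc 0%N 1%N isT; move: IHs => /=.
by case: x y {noasc} => [] [] //=; lia.
Qed.

(** The pairs start at the even position [2 * a], so their pluses sit at odd positions. The default
    value [false] agrees with the final minuses, so [k] needs no upper bound. *)
Lemma nth_Dpat (a b c k : nat) :
  nth false (Dpat a b c) k =
  (k < 2 * a)%N || (k < 2 * a + 2 * b)%N && odd k.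
Proof.
rewrite /Dpat nth_cat size_nseq nth_nseq; case: ltnP => //= le_ak.
have [l ->] : exists l, k = (2 * a + l)%N by exists (k - 2 * a)%N; lia.
have -> : (2 * a + l - 2 * a = l)%N by lia.
rewrite oddD oddM /= ltn_add2l => {le_ak k}.
elim: b l => [|b IHb] l /=; first by rewrite nth_nseq if_same.
case: l => [|[|l]] //=; first lia.
rewrite IHb negbK; congr (_ && _); lia.
Qed.

Lemma size_Dpat (a b c : nat) : size (Dpat a b c) = (2 * a + 2 * b + 2 * c)%N.
Proof.
rewrite /Dpat !size_cat !size_nseq -addnA; congr (_ + (_ + _))%N.
by elim: b => //= b ->; lia.
Qed.

(** Meant for [p] the position of the first minus and [q] that of the last plus: their parities make
    [p] and [q.+1] block boundaries. *)
Lemma block_lengths (d p q : nat) :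
  odd d -> ~~ odd p -> odd q -> (0 < p)%N -> (p < q)%N -> (q < d)%N ->
  exists a b c, [/\ (1 <= a)%N, (1 <= b)%N & (1 <= c)%N] /\
    [/\ p = (2 * a)%N, q.+1 = (2 * a + 2 * b)%N
      & (2 * a + 2 * b + 2 * c = d.+1)%N].
Proof.
move=> *; exists p./2, (q.+1 - p)./2, (d - q)./2.
by split; split; lia.
Qed.

(* Without such [i] and [j], every minus followed by a later plus sits at an odd degree and
   every plus preceded by a minus at an even one: this describes exactly the patterns [Dpat]. *)
Lemma ascent_exists (d : nat) (s : seq bool) :
  odd d -> sign_pattern d s -> compatible s 3 0 ->
  ~ (exists a b c : nat,
        [/\ (1 <= a)%N, (1 <= b)%N, (1 <= c)%N,
            (2 * a + 2 * b + 2 * c = d.+1)%N & s = Dpat a b c]) ->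
  nth false s d = false /\
  exists i j : nat, [/\ (0 < j)%N, (j < i)%N & (i < d)%N] /\
    [/\ nth false s (d - i) = false, nth false s (d - j) = true &
        ~~ odd i || odd j].
Proof.
move=> d_odd [sz_s hd_s] [ge3 [par _]] notD.
(* Compatibility with 3 makes the number of sign changes odd, so the last sign differs from the
   first. *)
have s_last : nth false s d = false.
  have: odd (sign_changes s) by lia.
  case: s sz_s hd_s {ge3 par notD} => //= x s [sz_s] ->.
  rewrite odd_sign_changes -sz_s; case: s {sz_s} => //= y s.
  by rewrite (last_nth false) /=; case: nth.
split=> //.
have hd0 : nth false s 0 = true by rewrite nth0.
pose ascent p q := [&& (p < q)%N, (q < d.+1)%N, ~~ nth false s p & nth false s q].
(* Here [p] and [q] are positions. As [d] is odd, position [p] and degree [d - p] have opposite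
   parities, so this is the wanted condition on [i = d - p] and [j = d - q]. *)
pose good p q := ascent p q && (odd p || ~~ odd q).
case: (boolP [exists p : 'I_d.+1, exists q : 'I_d.+1, good p q]).
  case/existsP=> p /existsP[q /andP[/and4P[pq qd sp sq] pqodd]].
  have q_d : nat_of_ord q <> d by move=> e; rewrite e s_last in sq.
  have p_0 : nat_of_ord p <> 0%N by move=> e; rewrite e hd0 in sp.
  exists (d - p)%N, (d - q)%N; split; first by split; lia.
  by rewrite !subKn; [split => //; [apply/negbTE | lia] | lia..].
move=> nogood; case: notD.
have asc_par p q : ascent p q -> ~~ odd p /\ odd q.
  move=> asc; have /and4P[pq qd _ _] := asc; have pd : (p < d.+1)%N by lia.
  move/existsPn: nogood => /(_ (Ordinal pd)) /existsPn /(_ (Ordinal qd)).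
  by rewrite /good /= asc /=; case: (odd p); case: (odd q).
have [p0 [q0 asc0]] : exists p q, ascent p q.
  case: (boolP [exists p : 'I_d.+1, exists q : 'I_d.+1, ascent p q]).
    by case/existsP=> p /existsP[q]; exists p, q.
  move=> noasc; have: (sign_changes s <= head false s)%N.
    apply: sign_changes_no_ascent => p q; rewrite sz_s => pq.
    have pd : (p < d.+1)%N by lia. have qd : (q < d.+1)%N by lia.
    move/existsPn: noasc => /(_ (Ordinal pd)) /existsPn /(_ (Ordinal qd)).
    rewrite /ascent /=; case: (nth false s p) (nth false s q) => [] [] //=; lia.
  by rewrite hd_s => le1; have := leq_trans ge3 le1.
have [pq0 q0d sp0 sq0] := and4P asc0.
have exm : exists p, ~~ nth false s p by exists p0.
have exM : exists q, nth false s q && (q < d.+1)%N by exists q0; rewrite sq0.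
have ubM q : nth false s q && (q < d.+1)%N -> (q <= d)%N by case/andP.
(* Take the first minus [p] and the last plus [q]. Between them, a minus at [k] forms an ascent with
   [q], so [k] is even; a plus at [k] forms one with [p], so [k] is odd. *)
case: (ex_minnP exm) => p sp p_min.
case: (ex_maxnP exM ubM) => q /andP[sq qd] q_max.
have pq : (p < q)%N.
  have p_le := p_min _ sp0; apply: leq_ltn_trans p_le (leq_trans pq0 _).
  by apply: q_max; rewrite sq0.
have [p_even q_odd] : ~~ odd p /\ odd q by apply: asc_par; apply/and4P.
have p_gt0 : (0 < p)%N by case: p sp {p_min p_even pq} => //; rewrite hd0.
have lt_qd : (q < d)%N.
  by rewrite ltn_neqAle -ltnS qd andbT; apply: contraTneq sq => ->; rewrite s_last.
have [a [b [c [[a_gt0 b_gt0 c_gt0] [pE qE dE]]]]] :=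
  block_lengths _ _ _ d_odd p_even q_odd p_gt0 pq lt_qd.
exists a, b, c; split=> //.
apply: (@eq_from_nth _ false); first by rewrite size_Dpat sz_s.
move=> k; rewrite sz_s nth_Dpat -qE -pE [(k < q.+1)%N]ltnS => kd.
have [kp|pk] /= := ltnP k p.
  by apply: contraLR kp => /p_min; rewrite -leqNgt.
have [kq|qk] /= := leqP k q.
  case sk: (nth false s k).
    have lt_pk : (p < k)%N.
      by rewrite ltn_neqAle pk andbT; apply: contraNneq sp => ->; rewrite sk.
    by have [|_ ->] := asc_par p k; first by apply/and4P.
  have lt_kq : (k < q)%N.
    by rewrite ltn_neqAle kq andbT; apply: contraTneq sq => <-; rewrite sk.
  by have [|/negbTE-> //] := asc_par k q; first by apply/and4P; rewrite sk.
by apply: contraTF qk => sk; rewrite -leqNgt q_max // sk.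
Qed.

(** * Trinomials on the positive half-line *)

Lemma horner_trinomial (R : comNzRingType) (a b c x : R) (m n : nat) :
  (a *: 'X^m + b *: 'X^n + c%:P).[x] = a * x ^+ m + b * x ^+ n + c.
Proof. by rewrite !hornerE. Qed.

(** Rolle gives two positive critical points. Up to a power of [t] the derivative is
    [m a t^(m-n) + n b], which for nonzero [a] has at most one positive root. *)
Lemma trinomial_three_roots (R : rcfType) (m n : nat) (a b c x y z : R) :
  (0 < n < m)%N -> 0 < x -> x < y -> y < z ->
  {in [:: x; y; z], forall t, a * t ^+ m + b * t ^+ n + c = 0} -> a = 0.
Proof.
move=> /andP[n_gt0 lt_nm] x_gt0 lt_xy lt_yz root_xyz.
pose p : {poly R} := a *: 'X^m + b *: 'X^n + c%:P.
have pE t : p.[t] = a * t ^+ m + b * t ^+ n + c by apply: horner_trinomial.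
have dpE t : 0 < t -> p^`().[t] = 0 -> m%:R * a * t ^+ (m - n) + n%:R * b = 0.
  move=> t_gt0; rewrite /p !derivE !(hornerE, hornerMn) => dp0.
  have : t ^+ n.-1 * (m%:R * a * t ^+ (m - n) + n%:R * b) = 0.
    rewrite -{}dp0; have -> : m.-1 = (n.-1 + (m - n))%N by lia.
    by rewrite exprD -[_ *+ m]mulr_natl -[_ *+ n]mulr_natl; ring.
  by move/eqP; rewrite mulf_eq0 expf_eq0 (gt_eqF t_gt0) andbF => /eqP.
have [//|u /[!in_itv]/= /andP[xu uy] /(dpE _ (lt_trans x_gt0 xu)) du] :=
  @poly_rolle _ x y p lt_xy.
  by rewrite !pE !root_xyz ?mem_head // !inE eqxx ?orbT.
have y_gt0 := lt_trans x_gt0 lt_xy.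
have [//|v /[!in_itv]/= /andP[yv vz] /(dpE _ (lt_trans y_gt0 yv)) dv] :=
  @poly_rolle _ y z p lt_yz.
  by rewrite !pE !root_xyz ?mem_head // !inE eqxx ?orbT.
have lt_uv : u ^+ (m - n) < v ^+ (m - n).
  rewrite ltrXn2r ?(lt_trans uy) //; first by rewrite -lt0n subn_gt0.
  by rewrite ltW // (lt_trans x_gt0).
have : m%:R * a * (v ^+ (m - n) - u ^+ (m - n)) = 0 by rewrite mulrBr; lra.
move/eqP; rewrite !mulf_eq0 subr_eq0 (gt_eqF lt_uv) orbF pnatr_eq0.
by case/orP=> /eqP //; lia.
Qed.

Lemma expr_sub_sign (R : realFieldType) (k l : nat) (x : R) :
  0 <= x -> (k <= l)%N -> 0 <= (x - 1) * (x ^+ l - x ^+ k).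
Proof.
move=> x_ge0 le_kl; have [le_x1|lt_1x] := leP x 1.
  by rewrite mulr_le0 ?subr_le0 // ler_wiXn2l.
by rewrite mulr_ge0 ?subr_ge0 ?(ltW lt_1x) // ler_weXn2l // ltW.
Qed.

(** Induction on [m - n]: raising [m = n + l] by one adds the sum over [i < n] of
    [(x - 1) (x^(n+l) - x^i)]. All these terms are nonnegative, and the one with [i = 0] is
    positive. *)
Lemma weighted_amgm (R : realFieldType) (m n : nat) (x : R) :
  (0 < n < m)%N -> 0 <= x -> x != 1 ->
  0 < n%:R * x ^+ m - m%:R * x ^+ n + (m - n)%:R.
Proof.
move=> /andP[n_gt0 lt_nm] x_ge0 x_neq1.
rewrite -(subnKC lt_nm); move: (m - n.+1)%N => k {lt_nm m}.
have step l : n%:R * x ^+ (n + l.+1) - (n + l.+1)%:R * x ^+ n + l.+1%:R =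
    n%:R * x ^+ (n + l) - (n + l)%:R * x ^+ n + l%:R +
    \sum_(i < n) (x - 1) * (x ^+ (n + l) - x ^+ i).
  rewrite -mulr_sumr sumrB sumr_const card_ord mulrBr -subrX1.
  by rewrite addnS exprS -mulr_natl -!natr1; ring.
have step_gt0 l : 0 < \sum_(i < n) (x - 1) * (x ^+ (n + l) - x ^+ i).
  case: n n_gt0 {step} => // n _; rewrite big_ord_recl expr0 ltr_wpDr //.
    by apply: sumr_ge0 => i _; rewrite expr_sub_sign //= /bump /=; have := ltn_ord i; lia.
  have xl_neq1 : x ^+ (n.+1 + l) - 1 != 0.
    by rewrite subr_eq0 -[X in _ == X](expr1n _ (n.+1 + l)) eqrXn2.
  rewrite lt_def mulf_neq0 ?xl_neq1 ?subr_eq0 //=.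
  by have := @expr_sub_sign _ 0 (n.+1 + l) x x_ge0 isT; rewrite expr0.
rewrite addSn -addnS; have -> : (n + k.+1 - n = k.+1)%N by lia.
elim: k => [|k IHk]; rewrite step; last exact: addr_gt0.
by have := step_gt0 0; rewrite !addn0 subrr addr0 add0r.
Qed.

(** Subtracting the equations at consecutive points eliminates the constant and leaves a 2 by 2
    system in [a] and [b]. If its determinant vanished, a trinomial with leading coefficient [v1]
    would vanish at [x], [y] and [z], contradicting [trinomial_three_roots]. *)
Lemma interpolation (R : rcfType) (i j : nat) (x y z : R) (p : {poly R}) :
  (0 < j < i)%N -> 0 < x -> x < y -> y < z ->
  exists a b c : R,
    all (root (p + (a *: 'X^i + b *: 'X^j + c%:P))) [:: x; y; z].
Proof.
move=> ji x_gt0 xy yz.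
pose u1 := y ^+ i - x ^+ i; pose u2 := z ^+ i - y ^+ i.
pose v1 := y ^+ j - x ^+ j; pose v2 := z ^+ j - y ^+ j.
have v1_neq0 : v1 != 0.
  rewrite subr_eq0 eqrXn2 ?(gt_eqF xy) //; [lia|exact: ltW (lt_trans _ xy)|exact: ltW].
have det_neq0 : u1 * v2 - v1 * u2 != 0.
  apply: contraNneq v1_neq0 => det0.
  rewrite (@trinomial_three_roots _ i j v1 (- u1)
    (u1 * x ^+ j - v1 * x ^+ i) x y z) // => t.
  rewrite !inE => /or3P[] /eqP->; rewrite /u1 /v1; try ring.
  rewrite -oppr0 -[in RHS]det0 /u1 /u2 /v1 /v2; ring.
pose q1 := p.[x] - p.[y]; pose q2 := p.[y] - p.[z].
pose a := (q1 * v2 - v1 * q2) / (u1 * v2 - v1 * u2).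
pose b := (u1 * q2 - q1 * u2) / (u1 * v2 - v1 * u2).
have e1 : a * u1 + b * v1 = q1 by rewrite /a /b; field.
have e2 : a * u2 + b * v2 = q2 by rewrite /a /b; field.
exists a, b, (- p.[y] - a * y ^+ i - b * y ^+ j).
move: e1 e2; rewrite /u1 /u2 /v1 /v2 /q1 /q2 => e1 e2.
rewrite /= !rootE hornerD horner_trinomial hornerD horner_trinomial hornerD horner_trinomial.
by apply/and4P; split=> //; apply/eqP; lra.
Qed.

(** * Stability of rootlessness under small perturbations *)

Lemma horner_reverse (R : fieldType) (n : nat) (q : {poly R}) (x : R) :
  (size q <= n.+1)%N -> x != 0 ->
  q.[x] = x ^+ n * (\poly_(k < n.+1) q`_(n - k)).[x^-1].
Proof.
move=> sz_q x_neq0; rewrite horner_poly (horner_coef_wide _ sz_q) mulr_sumr.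
rewrite (reindex_inj rev_ord_inj); apply: eq_bigr => k _ /=.
have le_kn : (k <= n)%N by rewrite -ltnS.
rewrite subSS mulrCA; congr (_ * _); rewrite exprVn expfB_cond //.
by rewrite (negPf x_neq0).
Qed.

Lemma poly_continuity (p : {poly Rdefinitions.R}) :
  Ranalysis1.continuity (fun x => p.[x]).
Proof.
elim/poly_ind: p => [|p c IHp].
  by apply: (@continuity_eq (fun=> 0)) => [x|]; [rewrite horner0|exact: Ranalysis1.continuity_const].
apply: (@continuity_eq (fun x => p.[x] * x + c)) => [x|]; first by rewrite !hornerE.
apply: Ranalysis1.continuity_plus; last exact: Ranalysis1.continuity_const.
apply: Ranalysis1.continuity_mult => //; exact: Ranalysis1.derivable_continuous Ranalysis1.derivable_id.
Qed.

Lemma perturbation_gt0 (R : realFieldType) (u v : R) : 0 < u ->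
  exists2 e, 0 < e & forall t, 0 < t <= e -> 0 < u + t * v.
Proof.
move=> u_gt0; have v1_gt0 : 0 < `|v| + 1 by rewrite ltr_wpDl.
exists (u / (`|v| + 1)); first exact: divr_gt0.
move=> t /andP[t_gt0]; rewrite ler_pdivlMr // mulrDr mulr1.
have : - (t * `|v|) <= t * v by rewrite -mulrN ler_pM2l // lerNnormlW.
lra.
Qed.

(** By compactness [F^2] has a positive minimum on the interval, where [G] is bounded by some [M]. A
    root of [F + t G] would give [F^2 = t^2 G^2 <= t M^2], which is below that minimum for small
    [t]. *)
Lemma perturbation_unit_itv (F G : {poly Rdefinitions.R}) :
  (forall x, -1 <= x <= 1 -> ~~ root F x) ->
  exists2 e, 0 < e & forall t x, 0 < t <= e -> -1 <= x <= 1 ->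
    ~~ root (F + t *: G) x.
Proof.
move=> F_neq0; have [M G_le] := poly_itv_bound G (-1) 1.
have le_N11 : Rdefinitions.Rle (-1) 1 by apply/RleP; lra.
have [c _|x0 [F_ge [/RleP x0_ge /RleP x0_le]]] :=
  @Rtopology.continuity_ab_min (fun x => (F ^+ 2).[x]) _ _ le_N11.
  exact: poly_continuity.
have m_gt0 : 0 < (F ^+ 2).[x0].
  by rewrite horner_exp exprn_even_gt0 //= F_neq0 // x0_ge.
have [e e_gt0 e_small] := perturbation_gt0 _ _ (- (M ^+ 2)) m_gt0.
(* The bound 1 ensures [t^2 <= t], so a threshold linear in [t] suffices. *)
exists (Num.min 1 e) => [|t x /andP[t_gt0]]; first by rewrite lt_min ltr01.
rewrite le_min => /andP[t_le1 t_le_e] /andP[x_ge x_le].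
apply/negP; rewrite rootE hornerD hornerZ addr_eq0 => /eqP Fx.
have /RleP : Rdefinitions.Rle (F ^+ 2).[x0] (F ^+ 2).[x].
  by apply: F_ge; split; apply/RleP.
rewrite [(_ ^+ 2).[x]]horner_exp Fx sqrrN exprMn leNgt => /negP; apply.
have /e_small : 0 < t <= e by rewrite t_gt0.
rewrite mulrN subr_gt0; apply: le_lt_trans.
apply: ler_pM; rewrite ?sqr_ge0 //.
  by rewrite expr2 ger_pMr.
have Gx_le : `|G.[x]| <= M by apply: G_le; rewrite x_ge.
rewrite -real_normK ?num_real // lerXn2r ?nnegrE ?normr_ge0 //.
exact: le_trans (normr_ge0 _) Gx_le.
Qed.

(** The line is not compact, but inversion sends the points outside [[-1, 1]] into it. There the
    reversed polynomials are treated by the same interval lemma. *)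
Lemma perturbation_no_root (F G : {poly Rdefinitions.R}) :
  (size G <= size F)%N -> (forall x, ~~ root F x) ->
  exists2 e, 0 < e & forall t x, 0 < t <= e -> ~~ root (F + t *: G) x.
Proof.
move=> le_GF F_neq0; have F0 : F != 0 by apply: contraNneq (F_neq0 0) => ->; rewrite root0.
pose n := (size F).-1; have szF : size F = n.+1 by rewrite prednK // size_poly_gt0.
(* Reversal about the fixed degree [n] is linear in [q], so it commutes with the perturbation. At 0,
   [rev F] takes the value of the leading coefficient of [F], hence is nonzero there. *)
pose rev (q : {poly Rdefinitions.R}) := \poly_(k < n.+1) q`_(n - k).
have [|e1 e1_gt0 H1] := perturbation_unit_itv F G; first by [].
have [x _|e2 e2_gt0 H2] := perturbation_unit_itv (rev F) (rev G).
  have [->|x_neq0] := eqVneq x 0.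
    by rewrite rootE horner_coef0 coef_poly /= subn0 lead_coef_eq0.
  have := F_neq0 x^-1; rewrite !rootE (@horner_reverse _ n) ?szF ?invr_eq0 //.
  by rewrite invrK mulf_eq0 negb_or => /andP[].
exists (Num.min e1 e2) => [|t x /andP[t_gt0]]; first by rewrite lt_min e1_gt0.
rewrite le_min => /andP[t1 t2].
have [x_small|x_large] := boolP (-1 <= x <= 1); first by apply: H1; rewrite ?t_gt0.
have x_neq0 : x != 0 by apply: contraNneq x_large => ->; lra.
have szFG : (size (F + t *: G)%R <= n.+1)%N.
  by rewrite (leq_trans (size_polyD _ _)) // geq_max szF leqnn -szF (leq_trans (size_scale_leq _ _)).
rewrite rootE (horner_reverse _ _ _ _ szFG x_neq0) mulf_neq0 ?expf_neq0 //.
have -> : \poly_(k < n.+1) (F + t *: G)`_(n - k) = rev F + t *: rev G.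
  by apply/polyP => k; rewrite !(coefD, coefZ, coef_poly); case: ltnP; rewrite // mulr0 addr0.
apply: H2; first by rewrite t_gt0.
rewrite -ler_norml normfV invf_le1 ?normr_gt0 //.
by rewrite ltW // ltNge ler_norml.
Qed.

(** * Four-term polynomials with exactly three real roots *)

Definition four_term {R : nzRingType} (d i j : nat) (e a b c : R) : {poly R} :=
  e *: 'X^d - a *: 'X^i + b *: 'X^j - c%:P.

Lemma horner_four_term (R : comNzRingType) (d i j : nat) (e a b c x : R) :
  (four_term d i j e a b c).[x] =
  e * x ^+ d - a * x ^+ i + b * x ^+ j - c.
Proof. by rewrite /four_term !hornerE. Qed.

Lemma coef_four_term (R : comNzRingType) (d i j : nat) (e a b c : R) (k : nat) :
  (four_term d i j e a b c)`_k =
  e * (k == d)%:R - a * (k == i)%:R + b * (k == j)%:R - c * (k == 0)%:R.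
Proof. by rewrite !coefE; case: (k == 0)%N; rewrite ?mulr1 ?mulr0. Qed.

(* A real root of [Q] would give the derivative, which is a monomial times a
   trinomial, a third positive root by Rolle's theorem. *)
Lemma four_term_cofactor_no_root (R : rcfType) (d i j : nat)
    (e a b c x y z : R) (Q : {poly R}) :
  (0 < j)%N -> (j < i)%N -> (i < d)%N -> e != 0 -> 0 < x -> x < y -> y < z ->
  let P := four_term d i j e a b c in
  (forall t, t <= 0 -> ~~ root P t) ->
  P = Q * \prod_(r <- [:: x; y; z]) ('X - r%:P) ->
  forall t, ~~ root Q t.
Proof.
move=> j_gt0 ji id e_neq0 x_gt0 xy yz P P_neq0 PE t; apply/negP => Qt.
have y_gt0 := lt_trans x_gt0 xy; have z_gt0 := lt_trans y_gt0 yz.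
have Pr r : r \in [:: x; y; z] -> P.[r] = 0.
  by move=> r_in; apply/rootP; rewrite PE rootM root_prod_XsubC r_in orbT.
have [Px Py Pz] : [/\ P.[x] = 0, P.[y] = 0 & P.[z] = 0].
  by split; apply: Pr; rewrite !inE eqxx ?orbT.
have Pt : P.[t] = 0 by apply/rootP; rewrite PE rootM Qt.
have t_gt0 : 0 < t by rewrite ltNge; apply/negP => /P_neq0; rewrite rootE Pt eqxx.
pose crit s := 0 < s /\ P^`().[s] = 0.
(* If [t] is one of [x], [y], [z], it is a multiple root of [P], hence itself a critical point. *)
have crit_double : t \in [:: x; y; z] -> crit t.
  move=> t_in; split=> //; rewrite PE derivM hornerD !hornerM.
  have /rootP-> : root (\prod_(r <- [:: x; y; z]) ('X - r%:P)) t by rewrite root_prod_XsubC.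
  by rewrite (rootP Qt) mulr0 mul0r addr0.
have crit_between p q : 0 < p -> p < q -> P.[p] = 0 -> P.[q] = 0 ->
    exists s, [/\ p < s, s < q & crit s].
  move=> p_gt0 pq Pp Pq; have [|s] := @poly_rolle _ p q P pq; first by rewrite Pp Pq.
  by rewrite in_itv /= => /andP[ps sq] ds; exists s; split=> //; split=> //; exact: lt_trans ps.
have critE s : crit s ->
    (d%:R * e) * s ^+ (d - j) + (- (i%:R * a)) * s ^+ (i - j) + j%:R * b = 0.
  move=> [s_gt0]; rewrite /P /four_term !derivE !(hornerE, hornerMn) => dP0.
  have /eqP : s ^+ j.-1 * (d%:R * e * s ^+ (d - j) + (- (i%:R * a)) * s ^+ (i - j) + j%:R * b) = 0.
    have dE : d.-1 = (j.-1 + (d - j))%N by clear -j_gt0 ji id; lia.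
    have iE : i.-1 = (j.-1 + (i - j))%N by clear -j_gt0 ji; lia.
    rewrite -{}dP0 dE iE.
    by rewrite !exprD -[_ *+ d]mulr_natl -[_ *+ i]mulr_natl -[_ *+ j]mulr_natl; ring.
  by rewrite mulf_eq0 expf_eq0 (gt_eqF s_gt0) andbF => /eqP.
have no3 p q r : crit p -> crit q -> crit r -> p < q -> q < r -> False.
  move=> Cp Cq Cr pq qr; have /eqP : d%:R * e = 0.
    apply: (@trinomial_three_roots _ (d - j) (i - j) _ (- (i%:R * a)) (j%:R * b) p q r) => //.
    - by clear -j_gt0 ji id; lia.
    - by case: Cp.
    - by move=> s; rewrite !inE => /or3P[] /eqP->; apply: critE.
  by rewrite mulf_eq0 (negPf e_neq0) orbF pnatr_eq0 => /eqP d0; rewrite d0 in id.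
have [u [xu uy Cu]] := crit_between _ _ x_gt0 xy Px Py.
have [v [yv vz Cv]] := crit_between _ _ y_gt0 yz Py Pz.
have uv := lt_trans uy yv.
(* Wherever [t] lies, three distinct critical points appear: consecutive distinct roots enclose one
   each, and a coincidence adds [t] itself to [u] and [v]. *)
have [tx|xt|tE] := ltgtP t x.
- have [w [_ wx Cw]] := crit_between _ _ t_gt0 tx Pt Px.
  exact: no3 Cw Cu Cv (lt_trans wx xu) uv.
- have [ty|yt|tE] := ltgtP t y.
  + have [w [_ wt Cw]] := crit_between _ _ x_gt0 xt Px Pt.
    have [w' [tw' w'y Cw']] := crit_between _ _ t_gt0 ty Pt Py.
    exact: no3 Cw Cw' Cv (lt_trans wt tw') (lt_trans w'y yv).
  + have [tz|zt|tE] := ltgtP t z.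
    * have [w [yw wt Cw]] := crit_between _ _ y_gt0 yt Py Pt.
      have [w' [tw' _ Cw']] := crit_between _ _ t_gt0 tz Pt Pz.
      exact: no3 Cu Cw Cw' (lt_trans uy yw) (lt_trans wt tw').
    * have [w [zw _ Cw]] := crit_between _ _ z_gt0 zt Pz Pt.
      exact: no3 Cu Cv Cw uv (lt_trans vz zw).
    * by apply: (no3 u v t) => //; [apply: crit_double; rewrite tE !inE eqxx !orbT | rewrite tE].
  + by apply: (no3 u t v) => //; [apply: crit_double; rewrite tE !inE eqxx !orbT | rewrite tE | rewrite tE].
- by apply: (no3 t u v) => //; [apply: crit_double; rewrite tE !inE eqxx | rewrite tE].
Qed.

Lemma three_roots_of_signs (R : rcfType) (p : {poly R}) (u v w : R) :
  0 < u -> u < v -> v < w -> p.[0] < 0 -> 0 < p.[u] -> p.[v] < 0 -> 0 < p.[w] ->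
  exists x y z : R, [/\ 0 < x, x < y & y < z] /\ all (root p) [:: x; y; z].
Proof.
move=> u_gt0 uv vw p0 pu pv pw.
have p0u : p.[0] * p.[u] < 0 by rewrite nmulr_rlt0.
have puv : p.[u] * p.[v] < 0 by rewrite pmulr_rlt0.
have pvw : p.[v] * p.[w] < 0 by rewrite nmulr_rlt0.
have [x /[!in_itv]/= /andP[x_gt0 xu] px] := poly_ivtoo (ltW u_gt0) p0u.
have [y /[!in_itv]/= /andP[uy yv] py] := poly_ivtoo (ltW uv) puv.
have [z /[!in_itv]/= /andP[vz zw] pz] := poly_ivtoo (ltW vw) pvw.
exists x, y, z; rewrite /= px py pz; split=> //; split=> //.
  exact: lt_trans xu uy.
exact: lt_trans yv vz.
Qed.

Lemma four_term_three_roots (R : rcfType) (d i j : nat) :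
  odd d -> (0 < j)%N -> (j < i)%N -> (i < d)%N -> ~~ odd i || odd j ->
  exists e a b c x y z : R,
    [/\ 0 < e, 0 < a, 0 < b & 0 < c] /\
    [/\ 0 < x, x < y & y < z] /\
    all (root (four_term d i j e a b c)) [:: x; y; z] /\
    (forall t, t <= 0 -> ~~ root (four_term d i j e a b c) t).
Proof.
move=> d_odd j_gt0 ji id ij_par.
have two_neq1 : (2%:R : R) != 1 by rewrite pnatr_eq1.
have hornerE0 e a b c : (four_term d i j e a b c).[0 : R] = - c.
  by rewrite horner_four_term !expr0n; case: d i j id ji j_gt0 {d_odd ij_par} => [|d'] [|i'] [|j'] //= _ _ _; ring.
case: (boolP (odd i)) => i_par; last first.
  (* The weighted AM-GM gap [S] is nonnegative with a double zero at 1, which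
     the small term [e x^d] lifts above the axis. *)
  pose S (x : R) := j%:R * x ^+ i - i%:R * x ^+ j + (i - j)%:R.
  have S_gt0 x : 0 <= x -> x != 1 -> 0 < S x by apply: weighted_amgm; lia.
  have S1 : S 1 = 0 by rewrite /S !expr1n natrB ?(ltnW ji) //; ring.
  have S_ge0 x : 0 <= x -> 0 <= S x.
    by have [->|x1] := eqVneq x 1; rewrite ?S1 // => x0; rewrite ltW // S_gt0.
  have S2 : 0 < S 2 by rewrite S_gt0.
  (* Chosen so that [e 2^d = S 2 / 2], whence [P.[2] = - S 2 / 2 < 0]. *)
  pose e := S 2 / (2 * 2 ^+ d).
  have e_gt0 : 0 < e by rewrite divr_gt0 // mulr_gt0 // exprn_gt0.
  pose P := four_term d i j e (j%:R) (i%:R) (i - j)%:R.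
  have PE x : P.[x] = e * x ^+ d - S x.
    by rewrite horner_four_term /S; ring.
  (* Since [e w >= j] and [w >= 1], the term [e w^d] dominates [j w^i]; moreover [i w^j] exceeds
     [i - j], so [P.[w] > 0]. *)
  pose w := 2 + j%:R / e.
  have w_gt2 : 2 < w by rewrite ltrDl divr_gt0 // ltr0n.
  have w_gt0 : 0 < w by apply: lt_trans w_gt2.
  have ij_gt0 : 0 < (i - j)%:R :> R by rewrite ltr0n subn_gt0.
  have [||||||| x [y [z [xyz roots]]]] := @three_roots_of_signs R P 1 2 w.
  - by [].
  - by rewrite ltr1n.
  - by [].
  - by rewrite /P hornerE0 oppr_lt0.
  - by rewrite PE S1 subr0 expr1n mulr1.
  - rewrite PE /e; have -> : S 2 / (2 * 2 ^+ d) * 2 ^+ d = S 2 / 2.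
      by field; rewrite expf_neq0 ?pnatr_eq0.
    by lra.
  - have wi : 1 <= w ^+ j by rewrite exprn_ege1 //; lra.
    have lead : j%:R * w ^+ i <= e * w ^+ d.
      rewrite -(subnK (ltnW id)) exprD mulrA ler_pM2r ?exprn_gt0 //.
      have le_w : w <= w ^+ (d - i) by rewrite ler_eXnr ?subn_gt0 //; lra.
      apply: le_trans (_ : e * w <= _); last by rewrite ler_pM2l.
      by rewrite /w mulrDr [e * (_ / _)]mulrC divfK ?gt_eqF // lerDr; lra.
    have : i%:R <= i%:R * w ^+ j by rewrite ler_peMr // ler0n.
    rewrite PE /S natrB ?(ltnW ji) //.
    have : 0 < j%:R :> R by rewrite ltr0n.
    lra.
  exists e, j%:R, i%:R, (i - j)%:R, x, y, z; split.
    by rewrite !ltr0n subn_gt0 ji j_gt0 (ltn_trans j_gt0).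
  (* With [d] odd and [i] even, [P(-t)] equals [- e t^d - S t] for [j] even, and is lower by
     [2 i t^j] for [j] odd. *)
  split=> //; split=> // t; rewrite -oppr_ge0 -[in root _ t](opprK t).
  move: (- t) => {}t t_ge0; rewrite rootE -/P PE lt_eqF //.
  have [->|t_neq0] := eqVneq t 0.
    by rewrite oppr0 -PE /P hornerE0 oppr_lt0.
  have t_gt0 : 0 < t by rewrite lt_def t_neq0.
  have etd : 0 < e * t ^+ d by rewrite mulr_gt0 ?exprn_gt0.
  have := S_ge0 _ t_ge0; have itj : 0 <= i%:R * t ^+ j by rewrite mulr_ge0 ?exprn_ge0.
  rewrite /S ![(- t) ^+ _]exprNn -signr_odd d_odd -(signr_odd _ i) (negPf i_par) -(signr_odd _ j).
  by case: (odd j); rewrite /= !expr1 expr0; nra.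
have j_par : odd j by move: ij_par; rewrite i_par.
(* Now [i] and [j] are both odd. The product [x^j G x] vanishes at 0 and 1 and is positive elsewhere
   on the positive half-line; subtracting a small constant [e] produces the three roots. *)
pose G (x : R) := (i - j)%:R * x ^+ (d - j) - (d - j)%:R * x ^+ (i - j) + ((d - j) - (i - j))%:R.
have G_gt0 x : 0 <= x -> x != 1 -> 0 < G x by apply: weighted_amgm; lia.
have G1 : G 1 = 0 by rewrite /G !expr1n [in X in _ + X]natrB; [ring | lia].
pose h : R := 2^-1.
have h_gt0 : 0 < h by rewrite invr_gt0.
have h_lt1 : h < 1 by rewrite invf_lt1 // ltr1n.
have Gh : 0 < h ^+ j * G h by rewrite mulr_gt0 ?exprn_gt0 // G_gt0 ?(ltW h_gt0) // lt_eqF.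
have G2 : 0 < 2 ^+ j * G 2 by rewrite mulr_gt0 ?exprn_gt0 // G_gt0.
(* Half the smaller of the values of [x^j G x] at [1/2] and 2, so that [P] is positive at both
   points. *)
pose e := Num.min (h ^+ j * G h) (2 ^+ j * G 2) / 2.
have e_gt0 : 0 < e by rewrite divr_gt0 // lt_min Gh.
have [e_lt_h e_lt_2] : e < h ^+ j * G h /\ e < 2 ^+ j * G 2.
  have : Num.min (h ^+ j * G h) (2 ^+ j * G 2) <= h ^+ j * G h by rewrite ge_min lexx.
  have : Num.min (h ^+ j * G h) (2 ^+ j * G 2) <= 2 ^+ j * G 2 by rewrite ge_min lexx orbT.
  by rewrite /e; split; lra.
pose P := four_term d i j (i - j)%:R (d - j)%:R (d - i)%:R e.
have PE x : P.[x] = x ^+ j * G x - e.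
  have dE : d = (j + (d - j))%N by rewrite subnKC // ltnW // (ltn_trans ji).
  have iE : i = (j + (i - j))%N by rewrite subnKC // ltnW.
  have diE : (d - j - (i - j) = d - i)%N by clear -ji id; lia.
  rewrite horner_four_term /G diE [x ^+ d](congr1 _ dE) [x ^+ i](congr1 _ iE).
  by rewrite !exprD; ring.
have [||||||| x [y [z [xyz roots]]]] := @three_roots_of_signs R P h 1 2.
- by [].
- by [].
- by rewrite ltr1n.
- by rewrite /P hornerE0 oppr_lt0.
- by rewrite PE subr_gt0.
- by rewrite PE G1 mulr0 sub0r oppr_lt0.
- by rewrite PE subr_gt0.
exists (i - j)%:R, (d - j)%:R, (d - i)%:R, e, x, y, z; split.
  by rewrite !ltr0n !subn_gt0 ji id (ltn_trans ji).
split=> //; split=> // t; rewrite -oppr_ge0 -[in root _ t](opprK t).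
(* The exponents [d], [i], [j] are all odd, so [x^j G x] is an odd polynomial and
   [P(-t) = - t^j G t - e < 0]. *)
move: (- t) => {}t t_ge0; rewrite rootE -/P lt_eqF //.
have : 0 <= t ^+ j * G t.
  rewrite mulr_ge0 ?exprn_ge0 //.
  by have [->|t1] := eqVneq t 1; rewrite ?G1 // ltW // G_gt0.
have -> : t ^+ j * G t = P.[t] + e by rewrite PE subrK.
rewrite !horner_four_term ![(- t) ^+ _]exprNn -signr_odd d_odd -(signr_odd _ i) i_par -(signr_odd _ j) j_par.
by rewrite /= !expr1; lra.
Qed.

(** * Filling in the missing monomials *)

Lemma deriv_prod_XsubC_neq0 (F : fieldType) (rs : seq F) (x : F) :
  uniq rs -> x \in rs -> ~~ root (\prod_(r <- rs) ('X - r%:P))^`() x.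
Proof.
move=> rs_uniq x_rs; have := separable_prod_XsubC rs; rewrite rs_uniq unlock => sep.
by rewrite rootE (coprimep_root sep) // root_prod_XsubC.
Qed.

(** The products in the sign hypothesis encode nonvanishing and sign at once. The leading
    coefficient is positive because the pattern starts with a plus, so normalizing preserves all
    signs. Simplicity holds because at a root the derivative of [q] is [T] times that of the
    product. *)
Lemma realizes_of_signs (d pos : nat) (s : seq bool) (q T : {poly Rdefinitions.R})
    (rs : seq Rdefinitions.R) :
  size s = d.+1 -> head false s = true -> size q = d.+1 ->
  (forall k, (k <= d)%N -> 0 < (-1) ^+ (~~ nth false s (d - k)) * q`_k) ->
  q = T * \prod_(r <- rs) ('X - r%:P) -> (forall x, ~~ root T x) ->
  uniq rs -> all (fun x => 0 < x) rs -> size rs = pos ->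
  realizes ((lead_coef q)^-1 *: q) s pos 0.
Proof.
move=> sz_s hd_s sz_q sgn_q qE T_neq0 rs_uniq rs_gt0 sz_rs.
have lead_gt0 : 0 < lead_coef q.
  have := sgn_q d (leqnn d); rewrite subnn nth0 hd_s expr0 mul1r.
  by rewrite lead_coefE sz_q.
have leadV_neq0 : (lead_coef q)^-1 != 0 by rewrite invr_eq0 gt_eqF.
split.
  rewrite /defines sz_s /= size_scale //; split=> //; split.
    by apply/monicP; rewrite lead_coefZ mulVf // gt_eqF.
  split=> k le_kd.
    rewrite coefZ mulf_neq0 //; have := sgn_q k le_kd.
    by apply: contraTneq => ->; rewrite mulr0 ltxx.
  rewrite coefZ pmulr_rgt0 ?invr_gt0 //.
  have := sgn_q _ (leq_subr k d); rewrite subKn //.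
  case: (nth false s k); rewrite /= ?expr1 ?expr0 ?mul1r ?mulN1r //.
  by rewrite oppr_gt0 => /ltW; rewrite leNgt => /negbTE.
exists rs, [::]; split=> //; split=> //; split=> //; rewrite cats0; split=> x.
  by rewrite rootZ // qE rootM root_prod_XsubC (negPf (T_neq0 x)).
move=> x_rs; rewrite derivZ rootZ // qE derivM rootE hornerD !hornerM.
have /rootP -> : root (\prod_(r <- rs) ('X - r%:P)) x by rewrite root_prod_XsubC.
rewrite mulr0 add0r mulf_neq0 //; first exact: T_neq0.
exact: deriv_prod_XsubC_neq0.
Qed.

Lemma ascent_realizable (d i j : nat) (s : seq bool) :
  odd d -> sign_pattern d s -> nth false s d = false ->
  (0 < j)%N -> (j < i)%N -> (i < d)%N ->
  nth false s (d - i) = false -> nth false s (d - j) = true ->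
  ~~ odd i || odd j ->
  exists p : {poly Rdefinitions.R}, realizes p s 3 0.
Proof.
move=> d_odd [sz_s hd_s] s_last j_gt0 ji id s_i s_j ij_par.
have [e [a [b [c [x [y [z [[e_gt0 a_gt0 b_gt0 c_gt0] [[x_gt0 xy yz] [P_roots P_neg]]]]]]]]]] :=
  four_term_three_roots Rdefinitions.R _ _ _ d_odd j_gt0 ji id ij_par.
set P := four_term _ _ _ _ _ _ _ in P_roots P_neg.
pose rs := [:: x; y; z]; pose W := \prod_(r <- rs) ('X - r%:P).
have rs_uniq : uniq rs.
  by rewrite /= !inE !negb_or !lt_eqF ?(lt_trans xy yz).
have rs_uroots := etrans (uniq_rootsE rs) rs_uniq.
have [Q0 PE] := uniq_roots_prod_XsubC P_roots rs_uroots.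
have Q0_neq0 : forall t, ~~ root Q0 t.
  by apply: four_term_cofactor_no_root PE => //; rewrite gt_eqF.
pose sg k : Rdefinitions.R := (-1) ^+ (~~ nth false s (d - k)).
(* [D] carries the prescribed signs at the degrees below [d] missing from [P]. Stopping below [d]
   keeps the degree of [Q1] at most that of [Q0], as the perturbation lemma requires. *)
pose D := \poly_(k < d) (if k \in [:: i; j; 0%N] then 0 else sg k).
have [|a' [b' [c' D_roots]]] := interpolation _ i j x y z D _ x_gt0 xy yz.
  by rewrite j_gt0.
set D' := D + _ in D_roots.
have [Q1 DE] := uniq_roots_prod_XsubC D_roots rs_uroots.
have coefP k : P`_k = e * (k == d)%:R - a * (k == i)%:R + b * (k == j)%:R - c * (k == 0)%:R.
  exact: coef_four_term.
have coefD' k : D'`_k = (if (k < d)%N then if k \in [:: i; j; 0%N] then 0 else sg k else 0)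
   + (a' * (k == i)%:R + b' * (k == j)%:R + c' * (k == 0)%:R).
  by rewrite /D' coefD coef_poly !coefE; case: (k == 0)%N; rewrite ?mulr1 ?mulr0.
have sizeP : size P = d.+1.
  apply/eqP; rewrite eqn_leq; apply/andP; split.
    apply/leq_sizeP => k lt_dk; rewrite coefP.
    rewrite !gtn_eqF ?mulr0 ?subr0 ?addr0 //; clear -j_gt0 ji id lt_dk; lia.
  rewrite ltnNge; apply/negP => /leq_sizeP /(_ _ (leqnn d)) /eqP.
  by rewrite coefP eqxx !gtn_eqF ?mulr0 ?subr0 ?addr0 ?mulr1 ?gt_eqF //; clear -j_gt0 ji id; lia.
have sizeD' : (size D' <= d)%N.
  apply/leq_sizeP => k le_dk; rewrite coefD' ltnNge le_dk /=.
  by rewrite !gtn_eqF ?mulr0 ?addr0 //; clear -j_gt0 ji id le_dk; lia.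
have W_monic : W \is monic by apply: monic_prod_XsubC.
have sizeW (Q : {poly Rdefinitions.R}) : Q != 0 -> size (Q * W)%R = (size Q + 3)%N.
  by move=> Q_neq0; rewrite size_Mmonic // size_prod_XsubC addnS.
have sizeQ : (size Q1 <= size Q0)%N.
  have [->|Q1_neq0] := eqVneq Q1 0; first by rewrite size_poly0.
  have Q0_nz : Q0 != 0 by apply: contraNneq (Q0_neq0 0) => ->; rewrite root0.
  move: sizeP sizeD'; rewrite PE DE !sizeW // => szQ0 szQ1.
  by rewrite -(leq_add2r 3) szQ0 leqW.
have [t0 t0_gt0 Q_neq0] := perturbation_no_root _ _ sizeQ Q0_neq0.
have [t1 t1_gt0 sgn_i] := perturbation_gt0 _ _ (- a') a_gt0.
have [t2 t2_gt0 sgn_j] := perturbation_gt0 _ _ b' b_gt0.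
have [t3 t3_gt0 sgn_0] := perturbation_gt0 _ _ (- c') c_gt0.
(* [t0] keeps the cofactor rootless; [t1], [t2], [t3] keep the signs at degrees [i], [j], 0 despite
   the interpolation corrections. *)
pose t := Num.min (Num.min t0 t1) (Num.min t2 t3).
have t_gt0 : 0 < t by rewrite !lt_min t0_gt0 t1_gt0 t2_gt0.
have /and4P[tt0 tt1 tt2 tt3] : [&& t <= t0, t <= t1, t <= t2 & t <= t3].
  by have := lexx t; rewrite {2}/t !le_min -andbA.
exists ((lead_coef (P + t *: D'))^-1 *: (P + t *: D')).
apply: (@realizes_of_signs d 3 s _ (Q0 + t *: Q1) rs) => //.
- by rewrite size_polyDl // sizeP ltnS (leq_trans (size_scale_leq _ _)).
- move=> k le_kd; rewrite coefD coefZ coefP coefD' !inE.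
  have [->|k_neq_d] := eqVneq k d.
    rewrite ltnn !gtn_eqF ?subnn ?nth0 ?hd_s //; try by clear -j_gt0 ji id; lia.
    by rewrite /= expr0 !(mulr0, mulr1, addr0, subr0, mul1r).
  have -> /= : (k < d)%N by rewrite ltn_neqAle k_neq_d.
  have [->|k_neq_i] := eqVneq k i.
    rewrite !gtn_eqF ?s_i //=; try by clear -j_gt0 ji id; lia.
    rewrite expr1 !(mulr0, mulr1, addr0, add0r, oppr0).
    by have := sgn_i t; rewrite t_gt0 tt1 => /(_ isT); rewrite mulN1r opprD opprK mulrN.
  have [->|k_neq_j] := eqVneq k j.
    rewrite !gtn_eqF ?s_j //=; try by clear -j_gt0 ji id; lia.
    rewrite expr0 !(mulr0, mulr1, mul1r, addr0, add0r, subr0, oppr0).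
    by apply: sgn_j; rewrite t_gt0.
  have [->|k_neq_0] := eqVneq k 0%N.
    rewrite subn0 s_last /=.
    rewrite expr1 !(mulr0, mulr1, addr0, add0r, oppr0).
    by have := sgn_0 t; rewrite t_gt0 tt3 => /(_ isT); rewrite mulN1r opprD opprK mulrN.
  (* At the remaining degrees the coefficient is [t * sg k], and the square of a sign is 1. *)
  by rewrite /= !mulr0 !addr0 !subr0 add0r mulrCA -expr2 sqrr_sign mulr1.
- by rewrite mulrDl -scalerAl -PE -DE.
- by move=> u; apply: Q_neq0; rewrite t_gt0.
- by rewrite /= x_gt0 (lt_trans x_gt0 xy) (lt_trans _ yz) ?(lt_trans x_gt0 xy).
Qed.

Theorem theorem5 (d : nat) (s : seq bool) :
  odd d -> sign_pattern d s -> compatible s 3 0 ->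
  ~ (exists a b c : nat,
        [/\ (1 <= a)%N, (1 <= b)%N, (1 <= c)%N,
            (2 * a + 2 * b + 2 * c = d.+1)%N & s = Dpat a b c]) ->
  exists p : {poly Rdefinitions.R}, realizes p s 3 0.
Proof.
move=> d_odd s_pat s_compat notD.
have [s_last [i [j [[j_gt0 ji id] [s_i s_j ij_par]]]]] :=
  ascent_exists _ _ d_odd s_pat s_compat notD.
exact: ascent_realizable s_last j_gt0 ji id s_i s_j ij_par.
Qed.
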